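(* Let $n\ge 2$. There is a constant $C$, depending only on $n$, such that every convex polytope $P\subset\mathbb{H}^n$ with $N$ vertices satisfies $$ r(P)\le C\log N .$$ That is, $r(P)=O(\log N)$.
   Context: $\mathbb{H}^n$ is hyperbolic $n$-space. A convex polytope $P\subset\mathbb{H}^n$ is an $n$-dimensional convex polytope with finitely many faces and no hyperideal vertices, i.e. the hyperbolic convex hull (with nonempty interior) of finitely many points of $\mathbb{H}^n\cup\partial\mathbb{H}^n$; its vertices may be finite (in $\mathbb{H}^n$) or ideal (in $\partial\mathbb{H}^n$), and both kinds are counted in $N$. The radius $r(P)$ is the radius of the largest hyperbolic ball contained in $P$. *)

(* Defs.v *)
From HB Require Import structures.
From mathcomp Require Import all_boot all_order all_algebra.
From mathcomp Require Import all_classical all_reals all_analysis.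

Set Implicit Arguments.
Unset Strict Implicit.
Unset Printing Implicit Defensive.

Import Order.TTheory GRing.Theory Num.Theory.
Import numFieldNormedType.Exports.

Local Open Scope classical_set_scope.
Local Open Scope ring_scope.

(* Hyperbolic n-space is taken in the Beltrami-Klein (projective) model: its
   points are those of the open Euclidean unit ball of 'rV[R]_n, its ideal
   points those of the unit sphere, and its geodesics the chords of the ball.
   Hence the geodesic segment between two points, finite or ideal, is the
   affine segment, and hyperbolic convexity is affine convexity.  The model and
   Euclidean topologies agree on the open ball.  The norm `|x| of 'rV[R]_n is
   the sup norm, hence the explicit inner product below. *)

Definition dotv (R : realType) (n : nat) (x y : 'rV[R]_n) : R :=
  \sum_(i < n) x 0 i * y 0 i.

Definition hspace (R : realType) (n : nat) : set 'rV[R]_n :=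
  [set x | dotv x x < 1].

Definition hideal (R : realType) (n : nat) : set 'rV[R]_n :=
  [set x | dotv x x = 1].

Definition arcosh (R : realType) (x : R) : R := ln (x + Num.sqrt (x ^+ 2 - 1)).

(* The metric of constant curvature -1; meaningful for x and y in hspace only. *)
Definition hdist (R : realType) (n : nat) (x y : 'rV[R]_n) : R :=
  arcosh ((1 - dotv x y) /
          (Num.sqrt (1 - dotv x x) * Num.sqrt (1 - dotv y y))).

Definition hball (R : realType) (n : nat) (c : 'rV[R]_n) (r : R) :
    set 'rV[R]_n :=
  [set x | hspace x /\ hdist c x <= r].

Definition convex_hull (R : realType) (n : nat) (S : set 'rV[R]_n) :
    set 'rV[R]_n :=
  smallest (@convex_set R 'rV[R]_n) S.

Definition extreme_points (R : realType) (n : nat) (A : set 'rV[R]_n) :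
    set 'rV[R]_n :=
  [set v | A v /\ forall x y (t : R), A x -> A y -> 0 < t < 1 ->
                    v = t *: x + (1 - t) *: y -> x = y].

(* The hull of S in the closed ball contains the ideal points of S; the
   polytope itself is the part of the hull lying in hyperbolic space. *)
Definition hpolytope (R : realType) (n : nat) (P : set 'rV[R]_n) : Prop :=
  (exists S : set 'rV[R]_n,
     [/\ finite_set S, S `<=` @hspace R n `|` @hideal R n &
         P = convex_hull S `&` @hspace R n]) /\
  P° !=set0.

(* For a polytope P, the closure of P in 'rV[R]_n adds exactly the ideal
   vertices, so this set comprises both the finite and the ideal vertices. *)
Definition hvertices (R : realType) (n : nat) (P : set 'rV[R]_n) :
    set 'rV[R]_n :=
  extreme_points (closure P).

(* The supremum is taken in \bar R: with the real-valued sup, an unbounded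
   set of radii would be given radius 0. *)
Definition hradius (R : realType) (n : nat) (P : set 'rV[R]_n) : \bar R :=
  ereal_sup [set r%:E | r in [set r : R | 0 <= r /\
    exists2 c : 'rV[R]_n, hspace c & hball c r `<=` P]].

(* Main.v *)
Require Import Defs.
From HB Require Import structures.
From mathcomp Require Import all_boot all_order all_algebra.
From mathcomp Require Import all_classical all_reals all_analysis.
From mathcomp Require Import ring lra.

Set Implicit Arguments.
Unset Strict Implicit.
Unset Printing Implicit Defensive.

Import Order.TTheory GRing.Theory Num.Theory.
Import numFieldNormedType.Exports.

Local Open Scope classical_set_scope.
Local Open Scope ring_scope.

(** The vertices surround every ball of radius r contained in the polytope: on
    any supporting hyperplane of the ball, or beyond it, there is a vertex.  Seen from the centre, a vertex lying beyond the supporting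
    hyperplane in direction u makes with u an angle of cosine at least tanh r,
    so one vertex serves only directions within about 1 / cosh r of each other.
    A circle of directions contains about cosh r directions that are further
    apart than this; hence N is at least of the order of cosh r, that is, of
    the order of e ^ r, and r = O(log N).  A single circle of directions is
    enough, which is where the dimension being at least 2 enters.

    The centre c is arbitrary and is not moved to the origin.  A direction at c
    is a vector u with u.u - (c.u)^2 = 1: the Lorentz vector (c.u, u) is the one
    with spatial part u that is Lorentz-orthogonal to (1, c), and the quadratic
    form [tdot c] in u is its Lorentz norm.  The geodesic from c in direction u
    meets the sphere of radius r at a point x where an affine functional
    depending on u and tanh r vanishes ([hdist_exp_point]).  That functional is
    therefore nonnegative at some extreme point of the closure of the polytope
    ([extreme_point_ge]).  If the functionals of u and u' are nonnegative at the
    same point of the closed ball, then u + u' has norm at least 2 tanh r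
    ([shared_vertex_directions]); by the parallelogram law u and u' are then at
    distance at most 2 / cosh r.  So pairwise more distant directions have
    distinct vertices ([separated_directions_le_card]).

    Two opposite directions give N >= 2, and the N + 1 directions of abscissa
    k / (N + 1) on the unit circle give cosh r <= 2 (N + 1).  Together they
    yield e ^ r <= N ^ 4 ([hball_radius_le]). *)

(** * The Euclidean inner product *)

Lemma dotvC (R : realType) (n : nat) (x y : 'rV[R]_n) : dotv x y = dotv y x.
Proof. by apply: eq_bigr => i _; rewrite mulrC. Qed.

Lemma dotvDl (R : realType) (n : nat) (x y z : 'rV[R]_n) :
  dotv (x + y) z = dotv x z + dotv y z.
Proof. by rewrite -big_split; apply: eq_bigr => i _; rewrite mxE mulrDl. Qed.

Lemma dotvZl (R : realType) (n : nat) (k : R) (x y : 'rV[R]_n) :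
  dotv (k *: x) y = k * dotv x y.
Proof.
by rewrite /dotv mulr_sumr; apply: eq_bigr => i _; rewrite mxE mulrA.
Qed.

Lemma dotvDr (R : realType) (n : nat) (x y z : 'rV[R]_n) :
  dotv x (y + z) = dotv x y + dotv x z.
Proof. by rewrite dotvC dotvDl !(dotvC x). Qed.

Lemma dotvZr (R : realType) (n : nat) (k : R) (x y : 'rV[R]_n) :
  dotv x (k *: y) = k * dotv x y.
Proof. by rewrite dotvC dotvZl dotvC. Qed.

Lemma dotvNl (R : realType) (n : nat) (x y : 'rV[R]_n) :
  dotv (- x) y = - dotv x y.
Proof. by rewrite -scaleN1r dotvZl mulN1r. Qed.

Lemma dotvNr (R : realType) (n : nat) (x y : 'rV[R]_n) :
  dotv x (- y) = - dotv x y.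
Proof. by rewrite dotvC dotvNl dotvC. Qed.

Definition dotvE := (dotvDl, dotvDr, dotvNl, dotvNr, dotvZl, dotvZr).

Lemma dotv_ge0 (R : realType) (n : nat) (x : 'rV[R]_n) : 0 <= dotv x x.
Proof. by apply: sumr_ge0 => i _; rewrite -expr2 sqr_ge0. Qed.

Lemma dotv_eq0 (R : realType) (n : nat) (x : 'rV[R]_n) : dotv x x = 0 -> x = 0.
Proof.
move=> /eqP; rewrite psumr_eq0 => [|i _]; last by rewrite -expr2 sqr_ge0.
move=> /allP x0; apply/rowP => i; rewrite mxE.
by have := x0 i (mem_index_enum i); rewrite -expr2 sqrf_eq0 => /eqP.
Qed.

Lemma sumR_continuous (R : realType) (T : topologicalType) (n : nat)
    (F : 'I_n -> T -> R) :
  (forall i, continuous (F i)) -> continuous (fun x => \sum_(i < n) F i x).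
Proof.
move=> cF; apply: continuous_big => [|i _]; last exact: cF.
exact: (@pseudometric_normed_Zmodule.add_continuous R R).
Qed.

Lemma dotv_continuous (R : realType) (n : nat) (a : 'rV[R]_n) :
  continuous (fun x : 'rV[R]_n => dotv a x).
Proof.
apply: sumR_continuous => i x.
by apply: continuousM; [exact: cst_continuous|exact: coord_continuous].
Qed.

Lemma dotvv_continuous (R : realType) (n : nat) :
  continuous (fun x : 'rV[R]_n => dotv x x).
Proof.
by apply: sumR_continuous => i x; apply: continuousM; exact: coord_continuous.
Qed.

(** * Extreme points of compact sets *)

(** The maximisers of the linear functional form a compact face of K.  A point
    of that face which is farthest from the origin is extreme, because the
    squared Euclidean norm is strictly convex. *)
Lemma extreme_point_ge (R : realType) (n : nat) (K : set 'rV[R]_n)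
    (a x : 'rV[R]_n) : compact K -> K x ->
  exists2 v, extreme_points K v & dotv a x <= dotv a v.
Proof.
move=> cK Kx.
have [c0] := EVT_max_rV (ex_intro _ x Kx) cK
  (continuous_subspaceT (@dotv_continuous R n a)).
rewrite inE => Kc0 c0max.
pose F := K `&` [set y | dotv a y >= dotv a c0].
have cF : compact F.
  apply: compact_closedI => //.
  apply: (@preimage_closed _ _ (dotv a) [set t | dotv a c0 <= t]).
    by move=> y _; exact: dotv_continuous.
  exact: closed_ge.
have [v] := EVT_max_rV (ex_intro _ c0 (conj Kc0 (lexx _))) cF
  (continuous_subspaceT (@dotvv_continuous R n)).
rewrite inE => -[Kv va] vmax.
exists v; last by apply: le_trans va; apply: c0max; rewrite inE.
split=> // y z t Ky Kz /andP[t0 t1] vE.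
have ya : dotv a y <= dotv a c0 by apply: c0max; rewrite inE.
have za : dotv a z <= dotv a c0 by apply: c0max; rewrite inE.
have va' : dotv a c0 <= t * dotv a y + (1 - t) * dotv a z.
  by move: va; rewrite /= vE !dotvE.
have Fy : dotv a c0 <= dotv a y by nra.
have Fz : dotv a c0 <= dotv a z by nra.
have yv : dotv y y <= dotv v v by apply: vmax; rewrite inE; split.
have zv : dotv z z <= dotv v v by apply: vmax; rewrite inE; split.
(* Strict convexity of the squared norm, in quantitative form. *)
have vvE : dotv v v = t * dotv y y + (1 - t) * dotv z z
    - t * (1 - t) * dotv (y - z) (y - z).
  rewrite vE !dotvE (dotvC z y); ring.
have d0 := dotv_ge0 (y - z).
have tt0 : 0 < t * (1 - t) by nra.
suff /dotv_eq0/subr0_eq : dotv (y - z) (y - z) = 0 by [].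
apply/eqP; rewrite eq_le d0 andbT -(pmulr_rle0 _ tt0).
nra.
Qed.

Lemma closure_hspace_compact (R : realType) (n : nat) (P : set 'rV[R]_n) :
  P `<=` @hspace R n -> compact (closure P) /\
  forall v, closure P v -> dotv v v <= 1.
Proof.
move=> PH.
have le1 v : closure P v -> dotv v v <= 1.
  suff cB : closed [set v : 'rV[R]_n | dotv v v <= 1].
    move/(closureS (B := [set v : 'rV[R]_n | dotv v v <= 1])).
    rewrite -(closure_id _).1//; apply => y /PH; exact: ltW.
  apply: (@preimage_closed _ _ (fun y : 'rV[R]_n => dotv y y) [set t | t <= 1]).
    by move=> y _; exact: dotvv_continuous.
  exact: closed_le.
split=> //; apply: (@subclosed_compact _ _
    [set v : 'rV[R]_n | forall i, `[-1, 1]%classic (v ord0 i)]).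
- exact: closed_closure.
- apply: (@rV_compact R n (fun=> `[-1, 1]%classic)) => i.
  exact: segment_compact.
- move=> v /le1 v1 i.
  have : v ord0 i ^+ 2 <= 1.
    apply: le_trans v1; rewrite /dotv (bigD1 i)//= -expr2 lerDl.
    by apply: sumr_ge0 => j _; rewrite -expr2 sqr_ge0.
  move=> v2; rewrite /= in_itv /= -ler_norml.
  by rewrite -(ler_pXn2r (n := 2)) ?nnegrE// expr1n
    real_normK ?num_real.
Qed.

(** * The tangent inner product *)

(** The Lorentz form of signature (n, 1) on the vectors (c.x, x) orthogonal to
    (1, c), which is the tangent space of the hyperboloid at the point over c.
    It is positive definite when c is in the open ball. *)
Definition tdot (R : realType) (n : nat) (c x y : 'rV[R]_n) : R :=
  dotv x y - dotv c x * dotv c y.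

(** Positivity of the squared Euclidean norm of x - (c.x) c; this replaces the
    Cauchy-Schwarz inequality. *)
Lemma tdot_ge (R : realType) (n : nat) (c x : 'rV[R]_n) :
  dotv c x ^+ 2 * (1 - dotv c c) <= tdot c x x.
Proof.
have := dotv_ge0 (x - dotv c x *: c).
by rewrite /tdot !dotvE (dotvC x c); nra.
Qed.

Lemma tdot_ge0 (R : realType) (n : nat) (c x : 'rV[R]_n) :
  hspace c -> 0 <= tdot c x x.
Proof.
rewrite /hspace /= => c1; apply: le_trans (tdot_ge c x).
by rewrite mulr_ge0 ?sqr_ge0// subr_ge0 ltW.
Qed.

Lemma tdot_gt0 (R : realType) (n : nat) (c x : 'rV[R]_n) :
  hspace c -> x != 0 -> 0 < tdot c x x.
Proof.
rewrite /hspace /= => c1 x0; have [s0|s0] := eqVneq (dotv c x) 0.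
  rewrite /tdot s0 mul0r subr0 lt_neqAle dotv_ge0 andbT eq_sym.
  by apply: contra x0 => /eqP/dotv_eq0 ->.
apply: lt_le_trans (tdot_ge c x).
by rewrite mulr_gt0 ?subr_gt0// exprn_even_gt0.
Qed.

(** Gram-Schmidt on the first two vectors of the canonical basis. *)
Lemma tdot_orthonormal_pair (R : realType) (n : nat) (c : 'rV[R]_n) :
  (2 <= n)%N -> hspace c -> exists u w : 'rV[R]_n,
    [/\ tdot c u u = 1, tdot c w w = 1 & tdot c u w = 0].
Proof.
move=> hn hc.
pose i0 := Ordinal (ltnW hn); pose i1 := Ordinal hn.
have norm x : x != 0 -> exists k : R, tdot c (k *: x) (k *: x) = 1.
  move=> x0; have q0 := tdot_gt0 hc x0.
  have s0 : Num.sqrt (tdot c x x) != 0 by rewrite sqrtr_eq0 -ltNge.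
  exists (Num.sqrt (tdot c x x))^-1.
  have -> : forall k, tdot c (k *: x) (k *: x) = k ^+ 2 * tdot c x x.
    by move=> k; rewrite /tdot !dotvE; ring.
  by rewrite exprVn sqr_sqrtr ?ltW// mulVf// gt_eqF.
pose e i : 'rV[R]_n := delta_mx 0 i.
have e0 : e i0 != 0.
  by apply/eqP => /rowP/(_ i0); rewrite !mxE !eqxx => /eqP; rewrite oner_eq0.
have [k u1] := norm _ e0.
set u := k *: e i0 in u1.
pose w := e i1 - tdot c u (e i1) *: u.
have w0 : w != 0.
  apply/eqP => /rowP/(_ i1); rewrite !mxE !eqxx /= !mulr0 subr0.
  by move=> /eqP; rewrite oner_eq0.
have [l w1] := norm _ w0.
exists u, (l *: w); split=> //.
have -> : tdot c u (l *: w) = l * tdot c u (e i1) * (1 - tdot c u u).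
  by rewrite /w /tdot !dotvE; ring.
by rewrite u1 subrr mulr0.
Qed.

(** * Points at a given distance and supporting hyperplanes *)

(** The point x is the end of the geodesic of direction u and length artanh T
    from c: its Lorentz vector is proportional to (1, c) + T e (c.u, u).  The
    last equation says that the Lorentz product of x with the unit vector
    (c.u, u) is T times minus its product with the normalisation
    (1, c) / e. *)
Lemma hdist_exp_point (R : realType) (n : nat) (c u : 'rV[R]_n) (T : R) :
  hspace c -> tdot c u u = 1 -> 0 <= T < 1 ->
  let e := Num.sqrt (1 - dotv c c) in
  exists x : 'rV[R]_n, [/\ hspace x,
    hdist c x = arcosh (Num.sqrt (1 - T ^+ 2))^-1 &
    T * (1 - dotv c x) = e * (dotv u x - dotv c u)].
Proof.
move=> hc u1 /andP[T0 T1] e.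
have c1 : 0 < 1 - dotv c c by rewrite subr_gt0.
have e0 : 0 < e by rewrite sqrtr_gt0.
have eE : e ^+ 2 = 1 - dotv c c by rewrite sqr_sqrtr// ltW.
pose s := dotv c u; pose k := T * e; pose d := 1 + k * s.
have s1 : s ^+ 2 * e ^+ 2 <= 1 by rewrite eE -[leRHS]u1; exact: tdot_ge.
have ks : `|k * s| < 1.
  rewrite -(ltr_pXn2r (n := 2)) ?nnegrE// expr1n real_normK ?num_real//.
  have -> : (k * s) ^+ 2 = T ^+ 2 * (s ^+ 2 * e ^+ 2) by rewrite /k; ring.
  have : T ^+ 2 < 1 by rewrite expr_lt1.
  have : 0 <= T ^+ 2 by exact: sqr_ge0.
  nra.
(* The time coordinate of (1, c) + T e (c.u, u) is positive. *)
have d0 : 0 < d by move: ks; rewrite ltr_norml => /andP[]; rewrite /d; lra.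
have uu : dotv u u = 1 + s ^+ 2 by rewrite -u1 /tdot /s; ring.
have cc : dotv c c = 1 - e ^+ 2 by rewrite eE; ring.
have dn0 : d != 0 by rewrite gt_eqF.
pose x := d^-1 *: (c + k *: u).
have cx : 1 - dotv c x = e ^+ 2 / d.
  by rewrite !dotvE -/s cc /d; field; exact: dn0.
have xx : 1 - dotv x x = (e / d) ^+ 2 * (1 - T ^+ 2).
  rewrite !dotvE (dotvC u c) -/s cc uu /d /k; field; exact: dn0.
have T2 : 0 < 1 - T ^+ 2 by rewrite subr_gt0 expr_lt1.
exists x; split.
- by rewrite /hspace /= -subr_gt0 xx mulr_gt0// exprn_gt0// divr_gt0.
- rewrite /hdist -/e xx cx sqrtrM ?sqr_ge0// sqrtr_sqr gtr0_norm ?divr_gt0//.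
  congr arcosh; field.
  by rewrite !gt_eqF ?sqrtr_gt0.
- rewrite cx !dotvE (dotvC u c) -/s uu /d /k; field; exact: dn0.
Qed.

(** Write the Lorentz vector (1, v) as a multiple of (1, c) plus a tangent
    vector; z below is that tangent vector, scaled by e ^ 2.  As (1, v) is not
    space-like, z has norm at most e G, with G = 1 - c.v, while its product with
    y = u + u' is at least 2 T G e.  The Cauchy-Schwarz inequality for [tdot c]
    then bounds the norm of y from below. *)
Lemma shared_vertex_directions (R : realType) (n : nat) (c v u u' : 'rV[R]_n)
    (T : R) :
  hspace c -> dotv v v <= 1 -> 0 <= T ->
  let e := Num.sqrt (1 - dotv c c) in
  T * (1 - dotv c v) <= e * (dotv u v - dotv c u) ->
  T * (1 - dotv c v) <= e * (dotv u' v - dotv c u') ->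
  4 * T ^+ 2 <= tdot c (u + u') (u + u').
Proof.
move=> hc v1 T0 e hu hu'.
have c1 : 0 < 1 - dotv c c by rewrite subr_gt0.
have e0 : 0 < e by rewrite sqrtr_gt0.
have eE : e ^+ 2 = 1 - dotv c c by rewrite sqr_sqrtr// ltW.
have cc : dotv c c = 1 - e ^+ 2 by rewrite eE; ring.
pose G := 1 - dotv c v.
have G0 : 0 < G.
  have := dotv_ge0 (c - v); rewrite !dotvE (dotvC v c) /G; lra.
pose y := u + u'; pose z := e ^+ 2 *: v - G *: c.
have cv : dotv c v = 1 - G by rewrite /G; ring.
have yz : 2 * T * G * e <= tdot c y z.
  have -> : tdot c y z = e ^+ 2 * (dotv y v - dotv c y).
    by rewrite /tdot !dotvE -(dotvC c u) -(dotvC c u') cv cc; ring.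
  have := ler_wpM2l (ltW e0) hu; have := ler_wpM2l (ltW e0) hu'.
  rewrite /y !dotvE /G; lra.
have zz : tdot c z z <= e ^+ 2 * G ^+ 2.
  have -> : tdot c z z = e ^+ 4 * (dotv v v - 1) + e ^+ 2 * G ^+ 2.
    by rewrite /tdot !dotvE (dotvC v c) cv cc; ring.
  have : 0 <= e ^+ 4 by rewrite exprn_ge0// ltW.
  nra.
(* Cauchy-Schwarz, as positivity at the combination that is optimal when all
   the bounds above are attained. *)
have := tdot_ge0 ((e * G) *: y - (2 * T) *: z) hc.
have -> : tdot c ((e * G) *: y - (2 * T) *: z) ((e * G) *: y - (2 * T) *: z)
   = (e * G) ^+ 2 * tdot c y y - 4 * T * (e * G) * tdot c y z
     + 4 * T ^+ 2 * tdot c z z.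
  rewrite /tdot !dotvE -!(dotvC c) (dotvC u' u) (dotvC v u) (dotvC v u'); ring.
have eG : 0 < e * G by rewrite mulr_gt0.
have h1 : 4 * T * (e * G) * (2 * T * G * e) <= 4 * T * (e * G) * tdot c y z.
  by rewrite ler_wpM2l// !mulr_ge0// ltW.
have h2 : 4 * T ^+ 2 * tdot c z z <= 4 * T ^+ 2 * (e ^+ 2 * G ^+ 2).
  by rewrite ler_wpM2l// mulr_ge0// sqr_ge0.
move=> h3.
have h4 : (e * G) ^+ 2 * (4 * T ^+ 2) <= (e * G) ^+ 2 * tdot c y y by lra.
by move: h4; rewrite ler_pM2l// exprn_gt0.
Qed.

(** * Hyperbolic functions *)

Definition tanhR (R : realType) (r : R) : R :=
  (expR r ^+ 2 - 1) / (expR r ^+ 2 + 1).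

Definition coshR (R : realType) (r : R) : R := (expR r + (expR r)^-1) / 2.

Lemma tanhR_itv (R : realType) (r : R) : 0 <= r -> 0 <= tanhR r < 1.
Proof.
move=> r0; rewrite /tanhR.
have p1 : 1 <= expR r ^+ 2.
  by rewrite -(expr1n R 2) ler_sqr ?nnegrE ?expR_ge0// -expR0 ler_expR.
by rewrite divr_ge0 ?ltr_pdivrMr ?mul1r ?subr_ge0//=; lra.
Qed.

Lemma tanhR_coshR (R : realType) (r : R) :
  1 - tanhR r ^+ 2 = (coshR r)^-1 ^+ 2.
Proof.
rewrite /tanhR /coshR; have := expR_gt0 r; set p := expR r => p0.
have p2 : 0 < p ^+ 2 by rewrite exprn_gt0.
by field; rewrite !gt_eqF//; nra.
Qed.

Lemma coshR_gt0 (R : realType) (r : R) : 0 < coshR r.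
Proof. by have p0 := expR_gt0 r; rewrite divr_gt0// addr_gt0// invr_gt0. Qed.

Lemma arcosh_coshR (R : realType) (r : R) : 0 <= r -> arcosh (coshR r) = r.
Proof.
move=> r0; rewrite -[RHS](expRK r) /arcosh; congr ln.
have p0 := expR_gt0 r.
have p1 : 1 <= expR r by rewrite -expR0 ler_expR.
have -> : coshR r ^+ 2 - 1 = ((expR r - (expR r)^-1) / 2) ^+ 2.
  by rewrite /coshR; field; rewrite gt_eqF.
rewrite sqrtr_sqr ger0_norm; first by rewrite /coshR; field; rewrite gt_eqF.
by rewrite divr_ge0// subr_ge0 (le_trans _ p1)// invf_le1.
Qed.

(** * Counting the vertices *)

(** The plane of directions is spanned by a pair that is orthonormal for
    [tdot c], so that (a i, b i) ranges over a Euclidean unit circle.  Two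
    directions with the same vertex satisfy |d i + d j| >= 2 tanh r, hence
    |d i - d j|^2 <= 4 - 4 tanh^2 r = 4 / cosh^2 r, which the separation
    hypothesis excludes. *)
Lemma separated_directions_le_card (R : realType) (n : nat)
    (P : set 'rV[R]_n) (N : nat) (c : 'rV[R]_n) (r : R) (m : nat)
    (a b : nat -> R) :
  (2 <= n)%N -> P `<=` @hspace R n -> (hvertices P #= `I_N)%card ->
  0 <= r -> hspace c -> hball c r `<=` P ->
  (forall i, (i < m)%N -> a i ^+ 2 + b i ^+ 2 = 1) ->
  (forall i j, (i < j < m)%N ->
     4 * (coshR r)^-1 ^+ 2 < (a i - a j) ^+ 2 + (b i - b j) ^+ 2) ->
  (m <= N)%N.
Proof.
move=> hn PH PN r0 hc cP ab1 sep.
have [cK K1] := closure_hspace_compact PH.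
have [u [w [uu ww uw]]] := tdot_orthonormal_pair hn hc.
have T01 := tanhR_itv r0; have /andP[T0 T1] := T01.
set T := tanhR r in T0 T1 T01.
pose e := Num.sqrt (1 - dotv c c).
pose d i := a i *: u + b i *: w.
have tdE i j : tdot c (a i *: u + b i *: w + (a j *: u + b j *: w))
      (a i *: u + b i *: w + (a j *: u + b j *: w))
    = (a i + a j) ^+ 2 + (b i + b j) ^+ 2.
  have -> : (a i + a j) ^+ 2 + (b i + b j) ^+ 2 =
     (a i + a j) ^+ 2 * tdot c u u + (b i + b j) ^+ 2 * tdot c w w
     + 2 * (a i + a j) * (b i + b j) * tdot c u w by rewrite uu ww uw; ring.
  by rewrite /tdot !dotvE (dotvC w u); ring.
have dd i : (i < m)%N -> tdot c (d i) (d i) = 1.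
  move=> im; rewrite -(ab1 i im).
  transitivity (a i ^+ 2 * tdot c u u + b i ^+ 2 * tdot c w w
     + 2 * a i * b i * tdot c u w); last by rewrite uu ww uw; ring.
  by rewrite /tdot /d !dotvE (dotvC w u); ring.
(* The vertex lying beyond the supporting hyperplane in direction d i; an
   arbitrary point for i out of range. *)
have /choice [f fP] : forall i, exists v, (i < m)%N ->
    hvertices P v /\ T * (1 - dotv c v) <= e * (dotv (d i) v - dotv c (d i)).
  move=> i; have [im|] := boolP (i < m)%N; last by exists 0.
  have [x [hx xr xT]] := hdist_exp_point hc (dd i im) T01.
  have Px : P x.
    apply: cP; split=> //; rewrite xr tanhR_coshR sqrtr_sqr ger0_norm.
      by rewrite invrK arcosh_coshR.
    by rewrite invr_ge0 ltW// coshR_gt0.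
  have [v Pv xv] := extreme_point_ge (e *: d i + T *: c) cK (subset_closure Px).
  exists v => _; split=> //.
  by move: xv xT; rewrite !(dotvDl (e *: _)) !dotvZl -/e; lra.
have finj : {in `I_m &, injective f}.
  suff lt_neq i j : (i < j < m)%N -> f i <> f j.
    move=> i j; rewrite !inE /= => im jm fij.
    have [ij|ji|//] := ltngtP i j.
      by case: (lt_neq i j); rewrite ?ij.
    by case: (lt_neq j i); rewrite ?ji.
  move=> ijm fij; have /andP[ij jm] := ijm; have im := ltn_trans ij jm.
  have [vi hi] := fP i im; have [_ hj] := fP j jm.
  rewrite -fij in hj.
  have v1 : dotv (f i) (f i) <= 1 by apply: K1; exact: vi.1.
  have := shared_vertex_directions hc v1 T0 hi hj.
  rewrite tdE; have := sep i j ijm; rewrite -tanhR_coshR -/T.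
  have := ab1 i im; have := ab1 j jm; lra.
rewrite -card_le_II -(card_le_eqr PN) -(card_le_eql (inj_card_eq finj)).
by apply: subset_card_le => _ [i im <-]; exact: (fP i im).1.
Qed.

(** The bound cosh r <= 2 (N + 1) alone does not bound r by a multiple of log N
    when N = 1; the two opposite directions exclude N < 2, and N >= 2 lets the
    additive constant be absorbed: e ^ r <= 4 (N + 1) <= 8 N <= N ^ 4. *)
Lemma hball_radius_le (R : realType) (n : nat) (P : set 'rV[R]_n) (N : nat)
    (c : 'rV[R]_n) (r : R) :
  (2 <= n)%N -> P `<=` @hspace R n -> (hvertices P #= `I_N)%card ->
  0 < r -> hspace c -> hball c r `<=` P -> r <= 4 * ln N%:R.
Proof.
move=> hn PH PN r0 hc cP.
have count m a b := @separated_directions_le_card R n P N c r m a b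
  hn PH PN (ltW r0) hc cP.
have ch0 := coshR_gt0 r.
have N2 : (2 <= N)%N.
  (* The directions (1, 0) and (-1, 0). *)
  apply: (count 2 (fun i => (-1) ^+ i) (fun=> 0)) => [i _|i j ij].
    by rewrite expr0n addr0 -exprM mulnC exprM sqrrN !expr1n.
  have [-> ->] : i = 0%N /\ j = 1%N
    by move: i j ij => [|[|i]] [|[|j]] // /andP[].
  rewrite -tanhR_coshR expr0 expr1 subrr.
  suff : 0 < tanhR r ^+ 2 by lra.
  rewrite exprn_gt0// divr_gt0//.
  by rewrite subr_gt0 exprn_egt1 ?expR_gt1.
have chN : coshR r <= 2 * N.+1%:R.
  rewrite leNgt; apply/negP => Nch.
  suff : (N.+1 <= N)%N by rewrite ltnn.
  have M0 : 0 < N.+1%:R :> R by rewrite ltr0n.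
  (* Abscissas spaced by 1 / (N + 1) > 2 / cosh r separate the directions. *)
  pose t i : R := i%:R / N.+1%:R.
  apply: (count N.+1 t (fun i => Num.sqrt (1 - t i ^+ 2)))
    => [i im|i j /andP[ij jm]].
    rewrite sqr_sqrtr; first by ring.
    rewrite subr_ge0 expr_le1 ?divr_ge0 ?ler0n//.
    by rewrite ler_pdivrMr// mul1r ler_nat ltnW.
  apply: (@lt_le_trans _ _ ((N.+1%:R)^-1 ^+ 2)).
    have -> : 4 * (coshR r)^-1 ^+ 2 = (2 / coshR r) ^+ 2 by ring.
    rewrite ltr_sqr ?nnegrE ?invr_ge0 ?divr_ge0 ?ler0n ?(ltW ch0)//.
    by rewrite ltr_pdivrMr// mulrC ltr_pdivlMr.
  rewrite -[leLHS]addr0 lerD ?sqr_ge0//.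
  have -> : (t i - t j) ^+ 2 = (t j - t i) ^+ 2 by ring.
  have -> : t j - t i = (j - i)%:R / N.+1%:R.
    by rewrite natrB 1?ltnW// /t; ring.
  rewrite ler_sqr ?nnegrE ?invr_ge0 ?divr_ge0 ?ler0n//.
  by rewrite ler_peMl ?invr_ge0 ?ler0n// ler1n subn_gt0.
have N2r : 2 <= N%:R :> R by rewrite ler_nat.
have rN : expR r <= N%:R ^+ 4.
  have : expR r <= 2 * coshR r.
    by rewrite /coshR mulrC divfK// lerDl invr_ge0 expR_ge0.
  rewrite -addn1 natrD in chN.
  move: N2r chN; set x := N%:R => x2 chN ex.
  have x3 : 8 <= x ^+ 3.
    have -> : 8 = 2 ^+ 3 :> R by ring.
    by rewrite lerXn2r ?nnegrE; lra.
  have : 8 * x <= x ^+ 4 by rewrite exprSr ler_wpM2r//; lra.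
  lra.
rewrite -[r]expRK mulrC mulr_natr -lnXn; last by rewrite ltr0n ltnW.
by rewrite ler_ln ?posrE ?expR_gt0 ?exprn_gt0// ltr0n ltnW.
Qed.

Theorem theorem6p3 (R : realType) (n : nat) (hn : (2 <= n)%N) :
  exists C : R, forall (P : set 'rV[R]_n) (N : nat),
    hpolytope P -> (hvertices P #= `I_N)%card ->
    (hradius P <= (C * ln N%:R)%:E)%E.
Proof.
exists 4 => P N [[S [_ _ PE]] _] PN.
have PH : P `<=` @hspace R n by rewrite PE; exact: subIsetr.
apply: ge_ereal_sup => _ [r [r0 [c hc cP]] <-]; rewrite lee_fin.
move: r0; rewrite le_eqVlt => /predU1P[<-|r0].
  (* Here ln N >= 0 is all that is claimed; ln 0 is 0 by convention. *)
  case: N {PN} => [|N]; first by rewrite ln0// mulr0.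
  by rewrite mulr_ge0// ln_ge0// ler1n.
exact: hball_radius_le PN r0 hc cP.
Qed.
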